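(* Let $R$ be an artinian ring and let $\mathcal{S}$ be a full subcategory of $\operatorname{Mod} R$ (the category of right $R$-modules) which is closed under (arbitrary) direct sums and under submodules, and with $R_R\in\mathcal{S}$. Suppose that, up to isomorphism, there are only finitely many indecomposable objects of finite length in $\mathcal{S}$. Then every object of $\mathcal{S}$ is a direct sum of finitely generated indecomposable submodules. In particular, every indecomposable module in $\mathcal{S}$ has finite length. *)

(* Defs.v *)
(* Right R-modules are modelled as left modules over the
   converse ring R^c (lmodType R^c); the regular right module R_R is (R^c)^o. *)
From HB Require Import structures.
From mathcomp Require Import all_boot all_order all_algebra.
From Stdlib Require List.
Set Implicit Arguments. Unset Strict Implicit. Unset Printing Implicit Defensive.
Import GRing.Theory.
Local Open Scope ring_scope.

Section ModDefs.
Variable R : pzRingType.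

Definition right_ideal (I : R -> Prop) :=
  I 0 /\ (forall x y, I x -> I y -> I (x + y)) /\ (forall x r, I x -> I (x * r)).
Definition left_ideal (I : R -> Prop) :=
  I 0 /\ (forall x y, I x -> I y -> I (x + y)) /\ (forall x r, I x -> I (r * x)).

Definition dcc (ideal : (R -> Prop) -> Prop) :=
  forall I : nat -> R -> Prop, (forall n, ideal (I n)) ->
    (forall n x, I n.+1 x -> I n x) ->
    exists n, forall m, (n <= m)%N -> forall x, I m x <-> I n x.

Definition artinian_ring := dcc right_ideal /\ dcc left_ideal.

Variable M : lmodType R.

Definition lin_fun (X : lmodType R) (f : X -> M) :=
  forall a x y, f (a *: x + y) = a *: f x + f y.

Definition submod (P : M -> Prop) :=
  P 0 /\ (forall a x y, P x -> P y -> P (a *: x + y)).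

Definition sumfam (I : Type) (P : I -> M -> Prop) (Q : I -> Prop) : M -> Prop :=
  fun m => exists (s : seq I) (x : I -> M),
    (forall j, List.In j s -> Q j /\ P j (x j)) /\ m = \sum_(j <- s) x j.

Definition indep (I : Type) (P : I -> M -> Prop) :=
  forall i m, P i m -> sumfam P (fun j => j <> i) m -> m = 0.

Definition indec (P : M -> Prop) :=
  submod P /\ (exists m, P m /\ m <> 0) /\
  forall A B : M -> Prop, submod A -> submod B ->
    (forall m, A m -> P m) -> (forall m, B m -> P m) ->
    (forall m, A m -> B m -> m = 0) ->
    (forall m, P m -> exists a b, A a /\ B b /\ m = a + b) ->
    (forall m, A m -> m = 0) \/ (forall m, B m -> m = 0).

Definition fingen (P : M -> Prop) :=
  submod P /\ exists s : seq M, (forall x, List.In x s -> P x) /\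
    forall m, P m <-> exists c : nat -> R, m = \sum_(i < size s) c i *: nth 0 s i.

Definition finlen (P : M -> Prop) :=
  submod P /\ exists (C : nat -> M -> Prop) (n : nat),
    (forall m, C 0%N m <-> m = 0) /\ (forall m, C n m <-> P m) /\
    forall k, (k < n)%N ->
      [/\ submod (C k), submod (C k.+1), (forall m, C k m -> C k.+1 m),
          (exists m, C k.+1 m /\ ~ C k m) &
          forall D, submod D -> (forall m, C k m -> D m) -> (forall m, D m -> C k.+1 m) ->
            (forall m, D m -> C k m) \/ (forall m, C k.+1 m -> D m)].

End ModDefs.

Definition mod_iso (R : pzRingType) (X Y : lmodType R) :=
  exists f : X -> Y, lin_fun f /\ bijective f.

(* the submodule P of M belongs (up to isomorphism) to the class S *)
Definition inS (R : pzRingType) (S : lmodType R -> Prop) (M : lmodType R) (P : M -> Prop) :=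
  exists (X : lmodType R) (f : X -> M),
    S X /\ lin_fun f /\ injective f /\ forall m, P m <-> exists x, f x = m.

Definition whole (T : Type) : T -> Prop := fun _ => True.

(* Main.v *)
(* The Hom functors (Y, -), with Y running over the finitely many
   indecomposables of finite length in S, turn every X in S into a flat functor,
   because the finite-length submodules of X are again sums of such Y; by the
   Harada-Sai lemma the radical is nilpotent, and then flat implies projective.
   Concretely: choose a maximal family of maps Y -> X that is independent modulo
   the radical of Hom (Y, X).  Nilpotency makes it generate Hom (Y, X), hence X.
   A relation sum f_a (x_a) = 0 lives in a finite-length submodule of X, and
   expanding the f_a through it yields x = k x for a matrix k of
   non-isomorphisms, so x = 0 by Harada-Sai. *)
Require Import Defs.
From HB Require Import structures.
From mathcomp Require Import all_boot all_order all_algebra.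
From mathcomp Require Import boolp classical_sets.
Set Implicit Arguments. Unset Strict Implicit. Unset Printing Implicit Defensive.
Import GRing.Theory.
Local Open Scope classical_set_scope.
Local Open Scope ring_scope.

(** * Submodules and relative length *)

(** A length bound is a recursion over proper submodules, so it serves directly as an induction
    principle. Finiteness of the list of indecomposables gives their lengths a common bound [b], and
    any composite of [2^b - 1] non-isomorphisms between the [Y i] vanishes. This is used at both
    ends: to rewrite an arbitrary map until its radical part has died, and to iterate [x = k x]. The
    entries of [k] are non-isomorphisms because each of its rows is the coefficient family of a
    relation whose value is 0, which lies in the radical; in this way independence modulo the
    radical becomes genuine independence. The chain condition enters through cyclic modules, which
    acquire finite length, so that every element of [X] lies in a finite-length submodule. For this,
    take a left ideal [K] minimal among those of infinite length. It is not a sum of two submodules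
    of finite length, and this lets [K = A K] be pushed down a composition series from the whole
    ring to the annihilator of [K], where it yields [K = 0]. *)

Section Linear.
Variable T : pzRingType.

Lemma linear_of_lin_fun (M N : lmodType T) (f : M -> N) :
  lin_fun f -> exists g : {linear M -> N}, f = g.
Proof.
move=> hf.
pose g : {linear M -> N} := HB.pack f (GRing.isLinear.Build T M N _ f hf).
by exists g.
Qed.

(** Source of the inverses, factorizations and projections below: each is given by its graph, and
    choice supplies the function. *)
Lemma linear_of_rel (M N : lmodType T) (r : M -> N -> Prop) :
  (forall x, exists y, r x y) ->
  (forall x y z, r x y -> r x z -> y = z) ->
  (forall a x1 x2 y1 y2, r x1 y1 -> r x2 y2 ->
     r (a *: x1 + x2) (a *: y1 + y2)) ->
  exists f : {linear M -> N}, forall x, r x (f x).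
Proof.
move=> /choice[f hf] r1 rlin.
have /linear_of_lin_fun[g fg] : lin_fun f.
  by move=> a x y; apply: r1 (hf _) _; apply: rlin.
by exists g => x; rewrite -fg.
Qed.

Lemma linear_inverse (M N : lmodType T) (f : {linear M -> N}) :
  bijective f -> exists g : {linear N -> M}, cancel f g /\ cancel g f.
Proof.
case=> h fK hK.
have [|||g gP] := @linear_of_rel N M (fun y x => f x = y).
- by move=> y; exists (h y).
- by move=> y x1 x2 <- /(can_inj fK).
- by move=> a y1 y2 x1 x2 <- <-; rewrite linearP.
by exists g; split=> // x; apply: (can_inj fK).
Qed.

Lemma inj_surj_bijective (A B : Type) (f : A -> B) :
  injective f -> (forall y, exists x, f x = y) -> bijective f.
Proof. by move=> finj /choice[g fg]; exists g => // x; exact: finj. Qed.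

Lemma linear_factor (M N X : lmodType T) (i : {linear N -> X})
    (f : {linear M -> X}) :
  injective i -> (forall x, exists y, i y = f x) ->
  exists g : {linear M -> N}, forall x, i (g x) = f x.
Proof.
move=> iinj fi; apply: (@linear_of_rel M N (fun x y => i y = f x)) => //.
- by move=> x y z <- /iinj.
- by move=> a x1 x2 y1 y2 e1 e2; rewrite !linearP e1 e2.
Qed.

End Linear.

Section Submodules.
Variable T : pzRingType.
Implicit Types M N : lmodType T.

Definition zerom M : M -> Prop := fun m => m = 0.

Definition addm M (A B : M -> Prop) : M -> Prop :=
  fun m => exists a b, [/\ A a, B b & m = a + b].

Definition cyc M (x : M) : M -> Prop := fun m => exists a : T, m = a *: x.

Lemma submodD M (A : M -> Prop) x y : submod A -> A x -> A y -> A (x + y).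
Proof. by move=> [_ h] Ax Ay; rewrite -[x]scale1r; apply: h. Qed.

Lemma submodZ M (A : M -> Prop) a x : submod A -> A x -> A (a *: x).
Proof. by move=> [h0 h] Ax; rewrite -[_ *: _]addr0; apply: h. Qed.

Lemma submodB M (A : M -> Prop) x y : submod A -> A x -> A y -> A (x - y).
Proof.
by move=> hA Ax Ay; rewrite -scaleN1r; apply: submodD => //; apply: submodZ.
Qed.

Lemma submod_sum M (A : M -> Prop) (I : Type) (s : seq I) (F : I -> M) :
  submod A -> (forall i, List.In i s -> A (F i)) -> A (\sum_(i <- s) F i).
Proof.
move=> hA; elim: s => [|i s IH] h; first by rewrite big_nil; case: hA.
rewrite big_cons; apply: submodD => //; first by apply: h; left.
by apply: IH => j js; apply: h; right.
Qed.

Lemma submod_zero M : submod (@zerom M).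
Proof. by split=> // a x y -> ->; rewrite /zerom scaler0 addr0. Qed.

Lemma submod_whole M : submod (@whole M).
Proof. by []. Qed.

Lemma zerom_sub M (A : M -> Prop) : submod A -> @zerom M `<=` A.
Proof. by move=> [h _] m ->. Qed.

Lemma submod_setI M (A B : M -> Prop) : submod A -> submod B -> submod (A `&` B).
Proof.
move=> [A0 hA] [B0 hB]; split=> // a x y [Ax Bx] [Ay By].
by split; [apply: hA|apply: hB].
Qed.

Lemma submod_addm M (A B : M -> Prop) : submod A -> submod B -> submod (addm A B).
Proof.
move=> [A0 hA] [B0 hB]; split; first by exists 0, 0; rewrite addr0.
move=> c _ _ [a [b [Aa Bb ->]]] [a' [b' [Aa' Bb' ->]]].
exists (c *: a + a'), (c *: b + b'); split; [exact: hA|exact: hB|].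
by rewrite scalerDr addrACA.
Qed.

Lemma addml M (A B : M -> Prop) : submod B -> A `<=` addm A B.
Proof. by move=> [B0 _] a Aa; exists a, 0; rewrite addr0. Qed.

Lemma addmr M (A B : M -> Prop) : submod A -> B `<=` addm A B.
Proof. by move=> [A0 _] b Bb; exists 0, b; rewrite add0r. Qed.

Lemma addm_sub M (A B C : M -> Prop) :
  submod C -> A `<=` C -> B `<=` C -> addm A B `<=` C.
Proof. by move=> hC AC BC _ [a [b [/AC Ca /BC Cb ->]]]; apply: submodD. Qed.

Lemma submod_cyc M (x : M) : submod (cyc x).
Proof.
split; first by exists 0; rewrite scale0r.
move=> c _ _ [a ->] [b ->]; exists (c * a + b).
by rewrite scalerDl scalerA.
Qed.

Lemma cyc_id M (x : M) : cyc x x.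
Proof. by exists 1; rewrite scale1r. Qed.

Lemma cyc_sub M (x : M) (A : M -> Prop) : submod A -> A x -> cyc x `<=` A.
Proof. by move=> hA Ax _ [a ->]; apply: submodZ. Qed.

Lemma submod_image M N (f : {linear M -> N}) (A : M -> Prop) :
  submod A -> submod (f @` A).
Proof.
move=> [A0 hA]; split; first by exists 0; rewrite ?linear0.
move=> a _ _ [x Ax <-] [y Ay <-]; exists (a *: x + y); first exact: hA.
by rewrite linearP.
Qed.

Lemma submod_preimage M N (f : {linear M -> N}) (B : N -> Prop) :
  submod B -> submod (f @^-1` B).
Proof.
move=> [B0 hB]; split; first by rewrite /preimage /= linear0.
by move=> a x y Bx By; rewrite /preimage /= linearP; apply: hB.
Qed.

Definition kerm M N (f : {linear M -> N}) : M -> Prop := f @^-1` (@zerom N).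

Lemma submod_ker M N (f : {linear M -> N}) : submod (kerm f).
Proof. exact/submod_preimage/submod_zero. Qed.

Lemma not_subP M (A B : M -> Prop) :
  ~ (A `<=` B) <-> exists m, A m /\ ~ B m.
Proof.
split=> [/existsNP[m /not_implyP h]|[m [Am nBm]] AB]; first by exists m.
exact/nBm/AB.
Qed.

End Submodules.

Section Length.
Variable T : pzRingType.
Implicit Types M N : lmodType T.

(* The quotient A / B has length at most n, stated without quotients. *)
Fixpoint lenle M (n : nat) (B A : M -> Prop) : Prop :=
  if n is n'.+1 then
    forall C, submod C -> B `<=` C -> C `<=` A -> ~ (A `<=` C) -> lenle n' B C
  else A `<=` B.

Lemma lenle_sub M n (B A A' : M -> Prop) : A' `<=` A -> lenle n B A -> lenle n B A'.
Proof.
case: n => [|n] /= A'A; first by apply: subset_trans.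
move=> h C hC BC CA' nA'C; apply: h => //; first exact: subset_trans CA' A'A.
by move=> sAC; apply: nA'C; apply: subset_trans sAC.
Qed.

Lemma lenleS M n (B A : M -> Prop) : lenle n B A -> lenle n.+1 B A.
Proof.
elim: n A => [|n IH] A.
  by move=> /= AB C hC BC CA nAC; apply: subset_trans AB.
move=> h C hC BC CA nAC; apply: IH; exact: h.
Qed.

Lemma lenle_leq M m n (B A : M -> Prop) : (m <= n)%N -> lenle m B A -> lenle n B A.
Proof.
move=> /subnKC <-; elim: (n - m)%N => [|k IH]; rewrite ?addn0 // addnS => h.
exact/lenleS/IH.
Qed.

(* A strictly monotone map between intervals of submodules transports length
   bounds backwards. *)
Lemma lenle_transport M N (phi : (M -> Prop) -> (N -> Prop))
    (B A : M -> Prop) (B' : N -> Prop) n :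
  submod B -> submod A -> B `<=` A ->
  (forall C, submod C -> B `<=` C -> C `<=` A -> submod (phi C) /\ B' `<=` phi C) ->
  (forall C D, C `<=` D -> phi C `<=` phi D) ->
  (forall C D, submod C -> submod D -> B `<=` C -> C `<=` D -> D `<=` A ->
     phi D `<=` phi C -> D `<=` C) ->
  lenle n B' (phi A) -> lenle n B A.
Proof.
move=> hB hA BA hphi mono strict.
have key : forall k D, submod D -> B `<=` D -> D `<=` A ->
    lenle k B' (phi D) -> lenle k B D.
  elim=> [|k IH] D hD BD DA /=.
    move=> h; apply: strict => //; apply: subset_trans h _.
    by have [_] := hphi B hB (@subset_refl _ B) BA.
  move=> h C hC BC CD nDC.
  have CA := subset_trans CD DA.
  have [sC BpC] := hphi C hC BC CA.
  apply: IH => //; apply: h => //; first exact: mono.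
  by move=> DC; apply: nDC; apply: strict.
exact: key.
Qed.

Lemma lenle_low M n (B B' A : M -> Prop) : submod B -> submod A ->
  B' `<=` B -> B `<=` A -> lenle n B' A -> lenle n B A.
Proof.
move=> hB hA B'B BA.
apply: (@lenle_transport M M id B A B') => // C hC BC CA; split=> //.
exact: subset_trans BC.
Qed.

Lemma lenle_low_strict M n (B B' A : M -> Prop) : submod B -> submod B' ->
  B `<=` B' -> B' `<=` A -> ~ (B' `<=` B) -> lenle n.+1 B A -> lenle n B' A.
Proof.
move=> hB hB' BB'; elim: n A => [|n IH] A B'A nB'B h.
  have [//|nAB'] := pselect (A `<=` B').
  by case: nB'B; apply: (h B').
move=> C hC B'C CA nAC; apply: IH => //; apply: h => //.
exact: subset_trans B'C.
Qed.

Lemma lenle_image_ker M N n (f : {linear M -> N}) (A : M -> Prop) :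
  submod A -> lenle n (A `&` kerm f) A -> lenle n (@zerom _ N) (f @` A).
Proof.
move=> hA h.
apply: (@lenle_transport N M (fun C => A `&` f @^-1` C) _ _ (A `&` kerm f)).
- exact: submod_zero.
- exact: submod_image.
- exact: (zerom_sub (submod_image _ hA)).
- move=> C hC C0 CfA; split; first exact/submod_setI/submod_preimage.
  by move=> m [Am fm0]; split=> //; rewrite /preimage /= fm0; case: hC.
- by move=> C D CD; apply: setIS => x /CD.
- move=> C D hC hD C0 CD DA DC y Dy; have [x Ax xy] := DA _ Dy.
  have [_] : (A `&` f @^-1` C) x.
    by apply: DC; split=> //; rewrite /preimage /= xy.
  by rewrite /preimage /= xy.
- by apply: lenle_sub h => x [].
Qed.

Lemma lenle_image M N n (f : {linear M -> N}) (A : M -> Prop) :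
  submod A -> lenle n (@zerom _ M) A -> lenle n (@zerom _ N) (f @` A).
Proof.
move=> hA h; apply: lenle_image_ker => //.
have hk := submod_setI hA (submod_ker f).
by apply: lenle_low h => //; apply: zerom_sub.
Qed.

(** A nonzero kernel element makes the kernel part of [A] use up at least one step of length; one of
    the two sources of the drop in Harada-Sai. *)
Lemma lenle_image_strict M N n (f : {linear M -> N}) (A : M -> Prop) x :
  submod A -> A x -> f x = 0 -> x <> 0 ->
  lenle n.+1 (@zerom _ M) A -> lenle n (@zerom _ N) (f @` A).
Proof.
move=> hA Ax fx0 x0 h; apply: lenle_image_ker => //.
have hk := submod_setI hA (submod_ker f).
apply: lenle_low_strict h => //; [exact: submod_zero|exact: zerom_sub|].
by move=> hx; apply: x0; apply: hx.
Qed.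

Lemma lenle_preimage M N n (f : {linear M -> N}) (A : M -> Prop) :
  submod A -> lenle n (@zerom _ N) (f @` A) -> lenle n (A `&` kerm f) A.
Proof.
move=> hA; apply: (@lenle_transport M N (fun C => f @` C)) => //.
- exact/submod_setI/submod_ker.
- by move=> C hC _ _; have hfC := submod_image f hC; split=> //; exact: zerom_sub.
- by move=> C D CD _ [x Cx <-]; exists x => //; apply: CD.
- move=> C D hC hD kC CD DA DC x Dx.
  have [|y Cy fyx] := DC (f x); first by exists x.
  rewrite -(subrK y x); apply: submodD => //; apply: kC; split.
    by apply: submodB => //; apply: DA => //; apply: CD.
  by rewrite /kerm /preimage /= /zerom linearB fyx subrr.
Qed.

Lemma lenle_addm_over M n (B C : M -> Prop) : submod B -> submod C ->
  lenle n (@zerom _ M) B -> lenle n C (addm B C).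
Proof.
move=> hB hC h; have hBC := submod_addm hB hC.
apply: (@lenle_transport M M (fun E => E `&` B) _ _ (@zerom _ M)) => //.
- exact: addmr.
- move=> D hD _ _; have hI := submod_setI hD hB.
  by split=> //; apply: zerom_sub.
- by move=> D E DE; apply: setSI.
- move=> D E hD hE CD DE EA ED x Ex.
  have [b [c [Bb Cc xE]]] := EA _ Ex; rewrite xE; apply: submodD => //; last exact: CD.
  have [//] : (D `&` B) b.
  apply: ED; split=> //; have -> : b = x - c by rewrite xE addrK.
  by apply: submodB => //; apply: DE; apply: CD.
- by apply: lenle_sub h => x [].
Qed.

(** By the modular law, shrinking [D] to a proper [D'] strictly shrinks [D ∩ C] or [D + C], so one
    of the two budgets [a], [b] pays for the step. *)
Lemma lenle_cat M a b (B C D : M -> Prop) : submod C -> submod D -> B `<=` C -> B `<=` D ->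
  lenle a B (D `&` C) -> lenle b C (addm D C) -> lenle (a + b) B D.
Proof.
move=> hC hD BC; move: hD; move nE: (a + b)%N => n; elim: n a b nE D => [|n IH] a b.
  case: a b => [|//] [|//] _ D hD BD /= h1 h2 x Dx; apply: h1; split=> //.
  exact/h2/addml.
move=> nE D hD BD ha hb D' hD' BD' D'D nDD'.
have sI : D' `&` C `<=` D `&` C by apply: setSI.
have sA : addm D' C `<=` addm D C.
  apply: addm_sub; [exact: submod_addm| |exact: addmr].
  exact: subset_trans (addml hC).
have [DCD'|nDCD'] := pselect (D `&` C `<=` D').
  case: b nE hb => [|b] nE hb.
    by case: nDD' => x Dx; apply: DCD'; split=> //; apply/hb/addml.
  apply: (IH a b) => //; first by move: nE; rewrite addnS => -[].
    exact: lenle_sub ha.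
  apply: hb => //; [exact: submod_addm|exact: addmr|].
  move=> h; apply: nDD' => x Dx; have [|d' [c [Dd' Cc xE]]] := h x.
    exact: addml.
  rewrite xE; apply: submodD => //; apply: DCD'; split=> //.
  have -> : c = x - d' by rewrite xE addrC addKr.
  by apply: submodB => //; apply: D'D.
case: a nE ha => [|a] nE ha; first by case: nDCD'; apply: subset_trans ha _.
apply: (IH a b) => //; first by move: nE; rewrite addSn => -[].
  apply: ha => //; first exact: submod_setI.
    by move=> x Bx; split; [exact: BD'|exact: BC].
  by move=> h'; apply: nDCD' => x /h' [].
exact: lenle_sub hb.
Qed.

End Length.

(** * Length bounds, composition series and finite generation *)

Section FiniteLength.
Variable T : pzRingType.
Implicit Types M N : lmodType T.

Lemma lenle_addm M a b (A B : M -> Prop) : submod A -> submod B ->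
  lenle a (@zerom _ M) A -> lenle b (@zerom _ M) B ->
  lenle (b + a) (@zerom _ M) (addm A B).
Proof.
move=> hA hB ha hb; have hAB := submod_addm hA hB.
apply: (@lenle_cat _ _ _ _ _ B) => //; [exact: zerom_sub|exact: zerom_sub| |].
  by apply: lenle_sub hb => x [].
apply: lenle_sub (lenle_addm_over hA hB ha).
by apply: addm_sub => //; apply: addmr.
Qed.

(** Were there none, every proper submodule could be enlarged and stay proper; iterating produces
    proper submodules whose length over [B] exceeds any [k], against the bound on [A]. *)
Lemma ex_maximal_submod M n (B A : M -> Prop) : submod B ->
  B `<=` A -> ~ (A `<=` B) -> lenle n B A ->
  exists C, [/\ submod C, B `<=` C, C `<=` A, ~ (A `<=` C) &
    forall D, submod D -> C `<=` D -> D `<=` A -> D `<=` C \/ A `<=` D].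
Proof.
move=> hB BA nAB hn; apply: contrapT => nmax.
have up C : submod C -> B `<=` C -> C `<=` A -> ~ (A `<=` C) ->
    exists D, [/\ submod D, C `<=` D, D `<=` A, ~ (D `<=` C) & ~ (A `<=` D)].
  move=> hC BC CA nAC; apply: contrapT => nD; apply: nmax; exists C; split=> //.
  move=> D hD CD DA; apply: contrapT => /not_orP[nDC nAD].
  by apply: nD; exists D.
suff /(_ n)[C [_ _ CA _]] : forall k, exists C,
    [/\ submod C, B `<=` C, C `<=` A, ~ (A `<=` C) & ~ lenle k B C].
  by apply; apply: lenle_sub hn.
elim=> [|k [C [hC BC CA nAC nk]]].
  by have [D [hD BD DA nDB nAD]] := up B hB (@subset_refl _ B) BA nAB; exists D.
have [D [hD CD DA nDC nAD]] := up C hC BC CA nAC.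
exists D; split=> //; first exact: subset_trans CD.
by move=> h; apply: nk; apply: h.
Qed.

Lemma finlen_of_lenle M n (A : M -> Prop) :
  submod A -> lenle n (@zerom _ M) A -> finlen A.
Proof.
elim: n A => [|n IH] A hA hn; split=> //; have [A0|nA0] := pselect (A `<=` @zerom _ M).
- exists (fun _ => @zerom _ M), 0%N; split=> //; split=> // m.
  by split=> [->|/A0//]; case: hA.
- by case: nA0.
- exists (fun _ => @zerom _ M), 0%N; split=> //; split=> // m.
  by split=> [->|/A0//]; case: hA.
have [B [hB _ BA nAB maxB]] :=
  ex_maximal_submod (submod_zero M) (zerom_sub hA) nA0 hn.
have [||_ [C [k [C0 [Ck hC]]]]] := IH B => //.
  by apply: hn => //; apply: zerom_sub.
have {Ck}Ck : C k = B by apply/funext => m; apply/propext.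
exists (fun i => if (i <= k)%N then C i else A), k.+1; split=> //.
split=> [m|i /=]; first by rewrite ltnn.
rewrite ltnS leq_eqVlt => /orP[/eqP ->|ik].
  by rewrite eqxx ltnn /= Ck; split=> //; first exact/not_subP.
rewrite ik orbT; exact: hC.
Qed.

(** [rank D] counts the factors of the series that [D] meets nontrivially. It is strictly monotone
    in [D], so every chain below [A] has at most [rank A] steps. *)
Lemma lenle_of_finlen M (A : M -> Prop) :
  finlen A -> exists n, lenle n (@zerom _ M) A.
Proof.
move=> [hA [C [n [C0 [Cn hC]]]]].
pose jump D k := `[< exists x, [/\ D x, C k.+1 x & ~ C k x] >].
pose rank D := (\sum_(k < n) jump D k)%N.
have rank_strict D D' : submod D -> submod D' -> D `<=` D' -> D' `<=` A ->
    (rank D' <= rank D)%N -> D' `<=` D.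
  move=> hD hD' DD' D'A.
  have jle (k : 'I_n) : (jump D k <= jump D' k)%N.
    rewrite /jump; case: asboolP => // -[x [Dx x1 x2]].
    by case: asboolP => // -[]; exists x; split=> //; apply: DD'.
  have /leqif_sum/geq_leqif -> : forall k : 'I_n, xpredT k ->
    (jump D k <= jump D' k ?= iff (jump D k == jump D' k :> nat))%N.
    by move=> k _; apply: leqif_eq.
  move=> /forallP jeq.
  (* Equal ranks force equal jumps at every index. Climbing the series, an element of [D'] new at
     stage [k.+1] is corrected by a multiple of some [y] in [D], since the factor is simple and
     generated by [y]. *)
  suff key : forall k, (k <= n)%N -> D' `&` C k `<=` D.
    by move=> x D'x; apply: (key n) => //; split=> //; apply/Cn/D'A.
  elim=> [_ x [_ /C0 ->]|k IH kn x [D'x Ckx]]; first by case: hD.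
  have [x'|nx] := pselect (C k x); first by apply: (IH (ltnW kn)).
  have [hCk hCk1 CkCk1 _ simple] := hC k kn.
  have [y [Dy y1 y2]] : exists y, [/\ D y, C k.+1 y & ~ C k y].
    have := jeq (Ordinal kn); rewrite implyTb eqn_leq => /andP[_].
    rewrite /jump /=; case: asboolP => [_|[]]; last by exists x.
    by case: asboolP.
  have [|||h|h] := simple (addm (C k) (cyc y)).
  - exact/submod_addm/submod_cyc.
  - exact: (addml (submod_cyc _)).
  - by apply: addm_sub => //; apply: cyc_sub.
  - by case: y2; apply: h; apply: addmr => //; apply: cyc_id.
  have [c [_ [Cc [a ->] xE]]] := h x Ckx.
  rewrite xE; apply: submodD => //; last exact: submodZ.
  apply: (IH (ltnW kn)); split=> //.
  have -> : c = x - a *: y by rewrite xE addrK.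
  by apply: submodB => //; apply: submodZ => //; apply: DD'.
have key j D : submod D -> D `<=` A -> (rank D <= j)%N -> lenle j (@zerom _ M) D.
  elim: j D => [|j IH] D hD DA rD.
    apply: rank_strict => //; [exact: submod_zero|exact: zerom_sub|].
    exact: leq_trans rD _.
  move=> E hE _ ED nDE; apply: IH => //; first exact: subset_trans DA.
  rewrite -ltnS; apply: leq_trans rD; rewrite ltnNge; apply/negP => r.
  by apply: nDE; apply: rank_strict.
by exists (rank A); apply: key.
Qed.

Lemma fingen_of_lenle M n (A : M -> Prop) :
  submod A -> lenle n (@zerom _ M) A -> fingen A.
Proof.
have base B : submod B -> B `<=` @zerom _ M -> fingen B.
  move=> hB B0; split=> //; exists [::]; split=> // m; split=> [/B0 ->|[c ->]].
    by exists (fun _ => 0); rewrite big_ord0.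
  by rewrite big_ord0; case: hB.
elim: n A => [|n IH] A hA hn; first exact: base.
have [/base//|nA0] := pselect (A `<=` @zerom _ M); first exact.
have [B [hB _ BA nAB maxB]] :=
  ex_maximal_submod (submod_zero M) (zerom_sub hA) nA0 hn.
have [||_ [s [sB Bs]]] := IH B => //.
  by apply: hn => //; apply: zerom_sub.
have [x [Ax nBx]] := (not_subP A B).1 nAB.
split=> //; exists (x :: s); split=> [y [<-//|/sB/BA//]|m].
split=> [Am|[c ->]].
  have [|||h|h] := maxB (addm B (cyc x)).
  - exact/submod_addm/submod_cyc.
  - exact: (addml (submod_cyc _)).
  - by apply: addm_sub => //; apply: cyc_sub.
  - by case: nBx; apply: h; apply: addmr => //; apply: cyc_id.
  have [_ [_ [/Bs[c ->] [a ->] ->]]] := h m Am.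
  exists (fun i => if i is j.+1 then c j else a).
  by rewrite /= big_ord_recl /= addrC.
rewrite /= big_ord_recl /=; apply: submodD => //; first exact: submodZ.
by apply: BA; apply/Bs; exists (fun i => c i.+1).
Qed.

Lemma lenle_whole_inj M N n (f : {linear M -> N}) : injective f ->
  lenle n (@zerom _ N) (range f) -> lenle n (@zerom _ M) (@whole M).
Proof.
move=> finj h; have := lenle_preimage (@submod_whole _ M) h.
apply: lenle_low => //; [exact: submod_zero|] => x [_].
by rewrite /kerm /preimage /= /zerom -(linear0 f) => /finj.
Qed.

Lemma submod_range M N (f : {linear M -> N}) : submod (range f).
Proof. exact: submod_image. Qed.

End FiniteLength.

(** * Left artinian rings have finite length *)

Section Hopkins.
Variable T : pzRingType.
Hypothesis dccT : dcc (@left_ideal T).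
Implicit Types (a : T) (x y : T^o).

Lemma orbit_linear (M : lmodType T) (m : M) :
  exists g : {linear T^o -> M}, forall a, g a = a *: m.
Proof.
have [|g gE] := @linear_of_lin_fun T T^o M (fun a => a *: m).
  by move=> a x y; rewrite scalerDl scalerA.
by exists g => a; rewrite -gE.
Qed.

Lemma left_ideal_submod (P : T^o -> Prop) : submod P -> @left_ideal T P.
Proof.
move=> hP; split; first by case: hP.
split=> [x y|x r]; first exact: (@submodD T T^o P x y hP).
exact: (@submodZ T T^o P r x hP).
Qed.

Lemma ex_minimal_submod (F : (T^o -> Prop) -> Prop) (P : T^o -> Prop) :
  (forall D, F D -> submod D) -> F P ->
  exists K, F K /\ forall D, F D -> D `<=` K -> K `<=` D.
Proof.
move=> Fsub FP; apply: contrapT => nmin.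
have step (K : {K | F K}) : exists D : {D | F D},
    sval D `<=` sval K /\ ~ (sval K `<=` sval D).
  case: K => K FK; apply: contrapT => nD; apply: nmin; exists K; split=> //.
  move=> D FD DK; apply: contrapT => nKD; apply: nD; by exists (exist _ D FD).
have [next nextP] := choice step.
pose I n := sval (iter n next (exist _ P FP)).
have [|n x|n hn] := dccT (I := I).
- by move=> n; apply: left_ideal_submod; apply: Fsub; exact: proj2_sig.
- exact: (nextP (iter n next _)).1.
- apply: (nextP (iter n next (exist _ P FP))).2 => x /(hn n (leqnn n)) h.
  exact/(hn n.+1 (leqnSn n)).
Qed.

Let fin (P : T^o -> Prop) := exists n, lenle n (@zerom T T^o) P.

(** * A left ideal minimal among those of infinite length *)

Section MinimalInfinite.
Variable K : T^o -> Prop.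
Hypothesis hK : submod K.
Hypothesis Kinf : ~ fin K.
Hypothesis Kmin : forall D, submod D -> D `<=` K -> ~ (K `<=` D) -> fin D.

Lemma minimal_infinite_hollow (C D : T^o -> Prop) :
  submod C -> submod D -> fin C -> fin D -> ~ (K `<=` addm C D).
Proof.
move=> hC hD [c hc] [d hd] KCD; apply: Kinf; exists (d + c)%N.
exact: lenle_sub (lenle_addm hC hD hc hd).
Qed.

(* Otherwise [K] is cyclic, and the elements not generating it form its unique
   maximal subideal. *)
Lemma fin_cyc x : K x -> fin (cyc x).
Proof.
move=> Kx; apply: contrapT => nfx.
have Kcx : K `<=` cyc x.
  by apply: contrapT => h; apply/nfx/Kmin; [exact: submod_cyc|exact: cyc_sub|].
pose U y := K y /\ ~ (K `<=` cyc y).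
have hU : submod U.
  split.
    split=> [|K0]; first by case: hK.
    by apply: Kinf; exists 0%N => y /K0 [a ->]; rewrite /zerom scaler0.
  move=> a y z [Ky ny] [Kz nz]; split; first by case: hK => _; apply.
  have fy := Kmin (submod_cyc y) (cyc_sub hK Ky) ny.
  have fz := Kmin (submod_cyc z) (cyc_sub hK Kz) nz.
  move=> h; apply: (minimal_infinite_hollow (submod_cyc y) (submod_cyc z) fy fz).
  apply: subset_trans h _ => _ [b ->].
  exists ((b * a) *: y), (b *: z); split; [by exists (b * a)|by exists b|].
  by rewrite scalerDr scalerA.
have UK : U `<=` K by move=> y [].
have [n hn] : fin U by apply: Kmin => // h; have [_ []] := h x Kx.
apply: Kinf; exists (n + 1)%N; apply: (@lenle_cat _ _ _ _ _ U) => //.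
- exact: zerom_sub.
- exact: zerom_sub.
- by apply: lenle_sub hn => y [].
(* The second summand 1: a proper [C] contains no generator of [K], hence lies in [U]. *)
move=> C hC UC CK nC y Cy; have KUK : addm K U `<=` K by apply: addm_sub.
split=> [|h]; first exact/KUK/CK.
by apply: nC; apply: subset_trans KUK _; apply: subset_trans h _; apply: cyc_sub.
Qed.

Definition annl (l : seq T^o) : T^o -> Prop :=
  fun a => forall x, List.In x l -> (a : T) *: x = 0.

Lemma submod_annl l : submod (annl l).
Proof.
split=> [x _|a b c hb hc x xl]; first by rewrite scale0r.
by rewrite scalerDl -scalerA hb // hc // scaler0 addr0.
Qed.

(** Each new [x] costs at most the length of [cyc x], because [a |-> a *: x] embeds
    [annl l / annl (x :: l)] into it. *)
Lemma lenle_annl l : (forall x, List.In x l -> K x) ->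
  exists n, lenle n (annl l) (@whole T^o).
Proof.
elim: l => [|x l IH] lK; first by exists 0%N => a _ x [].
have [|n hn] := IH; first by move=> y yl; apply: lK; right.
have [k hk] : fin (cyc x) by apply: fin_cyc; apply: lK; left.
have hl := submod_annl l; have hxl := submod_annl (x :: l).
have xll : annl (x :: l) `<=` annl l by move=> a h y yl; apply: h; right.
exists (k + n)%N; apply: (@lenle_cat _ _ _ _ _ (annl l)) => //; last first.
  by apply: lenle_sub hn.
have [g gE] := orbit_linear x.
have : lenle k (annl l `&` kerm g) (annl l).
  apply: lenle_preimage => //; apply: lenle_sub hk => _ [a _ <-].
  by exists a; rewrite gE.
move=> h; apply: (@lenle_sub _ _ _ _ (annl l)) => [a []//|].
apply: lenle_low h => // a [al]; rewrite /kerm /preimage /= /zerom gE => ax y [<-|/al] //.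
Qed.

(** The product ideal [A K], as the intersection of all submodules containing the products;
    inclusions out of it are then checked on products only. *)
Definition prodK (A : T^o -> Prop) : T^o -> Prop := fun y =>
  forall D, submod D -> (forall a x, A a -> K x -> D ((a : T) *: x)) -> D y.

Lemma submod_prodK A : submod (prodK A).
Proof.
split=> [D hD _|a x y hx hy D hD h]; first by case: hD.
by case: (hD) => _; apply; [exact: hx|exact: hy].
Qed.

Lemma prodK_in A a x : A a -> K x -> prodK A ((a : T) *: x).
Proof. by move=> Aa Kx D _; apply. Qed.

Lemma prodK_sub A D : submod D ->
  (forall a x, A a -> K x -> D ((a : T) *: x)) -> prodK A `<=` D.
Proof. by move=> hD h y; apply. Qed.

Lemma prodK_subK A : prodK A `<=` K.
Proof. by apply: prodK_sub => // a x _; apply: submodZ. Qed.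

Lemma ex_submod_avoiding (U : T^o -> Prop) w :
  submod U -> U `<=` K -> ~ U w ->
  exists V, [/\ submod V, U `<=` V, V `<=` K, ~ V w &
    forall D, submod D -> V `<=` D -> D `<=` K -> ~ D w -> D `<=` V].
Proof.
move=> hU UK nUw.
pose good V := [/\ submod V, U `<=` V, V `<=` K & ~ V w].
have Ugood : good U by split.
have [F Fgood Ftot|V [VP Vmax]] := @Zorn_bigcup T^o (fun V => V = set0 \/ good V).
  have [[V FV gV]|nF] := pselect (exists2 V, F V & good V); [right|left].
    have Fg V' x : F V' -> V' x -> good V'.
      by move=> /Fgood[->|].
    case: gV => hV UV VK nVw; split.
    - split; first by exists V => //; case: hV.
      move=> a x y [X FX Xx] [Y FY Yy].
      have [hX _ _ _] := Fg _ _ FX Xx; have [hY _ _ _] := Fg _ _ FY Yy.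
      have [XY|YX] := Ftot _ _ FX FY.
        by exists Y => //; case: (hY) => _; apply => //; apply: XY.
      by exists X => //; case: (hX) => _; apply => //; apply: YX.
    - by move=> x Ux; exists V => //; apply: UV.
    - by move=> x [X FX Xx]; have [_ _ + _] := Fg _ _ FX Xx; apply.
    - by move=> [X FX Xw]; have [_ _ _] := Fg _ _ FX Xw; apply.
  rewrite -subset0 => x [X FX Xx]; case: nF; exists X => //.
  by case: (Fgood _ FX) => // X0; move: Xx; rewrite X0.
case: VP => [V0|gV].
  exfalso; apply: (Vmax U); last by right.
  rewrite V0; split=> //= h; have : U 0 by case: hU.
  exact: h.
case: (gV) => hV UV VK nVw; exists V; split=> // D hD VD DK nDw.
apply: contrapT => nDV; apply: (Vmax D); first by split.
by right; split=> //; apply: subset_trans VD.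
Qed.

(* [K / BK] is a sum of quotients of the simple module [A / B]; a complement of
   one of its simple summands would be a proper subideal. *)
Lemma prodK_hollow (A B : T^o -> Prop) : submod A -> submod B -> B `<=` A ->
  (forall D, submod D -> B `<=` D -> D `<=` A -> D `<=` B \/ A `<=` D) ->
  K `<=` prodK A -> K `<=` prodK B.
Proof.
move=> hA hB BA simple KA; apply: contrapT => nKB.
have [a0 [x0 [Aa0 Kx0 nw]]] : exists a x,
    [/\ A a, K x & ~ prodK B ((a : T) *: x)].
  apply: contrapT => h; apply: nKB; apply: subset_trans KA _.
  apply: prodK_sub; first exact: submod_prodK.
  by move=> a x Aa Kx; apply: contrapT => n; apply: h; exists a, x.
move: nw; set w := _ *: _ => nw.
have Kw : K w by apply: submodZ.
have [V [hV BV VK nVw maxV]] :=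
  ex_submod_avoiding (submod_prodK B) (@prodK_subK B) nw.
have fV : fin V by apply: Kmin => // h; apply/nVw/h.
apply: (minimal_infinite_hollow hV (submod_cyc w) fV (fin_cyc Kw)).
have hVw := submod_addm hV (submod_cyc w).
apply: subset_trans KA _; apply: prodK_sub => // a x Aa Kx.
have [g gE] := orbit_linear x.
have hAx := submod_image g hA.
have hVAx := submod_addm hV hAx.
(* If [V + A x] misses [w], maximality of [V] puts [a *: x] in [V]. Otherwise [w = v + b *: x]; here
   [b] is outside [B], so [A = B + cyc b] by simplicity, and [a *: x] is expressed through [V] and
   [w]. *)
have [|nw'] := pselect (addm V (g @` A) w); last first.
  apply: (addml (submod_cyc w)); apply: (maxV _ hVAx) => //.
  - exact: addml.
  - by apply: addm_sub => // _ [b _ <-]; rewrite gE; apply: submodZ.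
  - by apply: addmr => //; exists a.
move=> [v [_ [Vv [b Ab <-] wE]]].
have [|||h|h] := simple (addm B (cyc b)).
- exact/submod_addm/submod_cyc.
- exact: (addml (submod_cyc b)).
- by apply: addm_sub => //; apply: cyc_sub.
- case: nVw; rewrite wE; apply: submodD => //; apply: BV; rewrite gE.
  by apply: prodK_in => //; apply: h; apply: addmr => //; apply: cyc_id.
have [b' [_ [Bb' [c ->] ->]]] := h a Aa.
rewrite scalerDl; apply: submodD => //.
  by apply: (addml (submod_cyc w)); apply: BV; apply: prodK_in.
rewrite -scalerA; apply: submodZ => //.
have -> : (b : T) *: x = w - v by rewrite wE addrC addKr gE.
apply: submodB => //; first by apply: (addmr hV); apply: cyc_id.
exact: (addml (submod_cyc w)).
Qed.

(** The ring has finite length over the annihilator of [K], and [K = A K] holds for [A] the whole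
    ring. [prodK_hollow] passes this down one simple factor at a time until [A] kills [K]; then [K]
    is zero, which has finite length. *)
Lemma no_minimal_infinite : False.
Proof.
pose F A := exists2 l, (forall x, List.In x l -> K x) & A = annl l.
have [||_ [[l lK ->] lmin]] := @ex_minimal_submod F (annl [::]).
- by move=> _ [l _ ->]; apply: submod_annl.
- by exists [::].
(* Adding one more [x] of [K] to [l] cannot shrink a minimal annihilator, so this finite list
   already has the annihilator of all of [K]. *)
have annK a x : annl l a -> K x -> (a : T) *: x = 0.
  move=> la Kx; apply: (lmin (annl (x :: l))) (la) _ _; last by left.
    by exists (x :: l) => // y [<-|/lK].
  by move=> b h y yl; apply: h; right.
have [n hn] := lenle_annl lK.
have key k A : submod A -> annl l `<=` A -> lenle k (annl l) A ->
    ~ (K `<=` prodK A).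
  elim: k A => [|k IH] A hA lA hk KA.
    apply: Kinf; exists 0%N; apply: subset_trans KA _; apply: prodK_sub.
      exact: submod_zero.
    by move=> a x /hk; apply: annK.
  have [Al|nAl] := pselect (A `<=` annl l).
    apply: Kinf; exists 0%N; apply: subset_trans KA _; apply: prodK_sub.
      exact: submod_zero.
    by move=> a x /Al; apply: annK.
  have [B [hB lB BA nAB maxB]] := ex_maximal_submod (submod_annl l) lA nAl hk.
  apply: (IH B) => //; first exact: hk.
  exact: prodK_hollow KA.
apply: (key n (@whole T^o)) => // x Kx.
by rewrite -[x]scale1r; apply: prodK_in.
Qed.

End MinimalInfinite.

Theorem artinian_finite_length : exists n, lenle n (@zerom T T^o) (@whole T^o).
Proof.
apply: contrapT => ninf.
have [||K [[hK Kinf] Kmin]] :=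
  @ex_minimal_submod (fun K => submod K /\ ~ fin K) (@whole T^o).
- by move=> D [].
- by [].
apply: (no_minimal_infinite hK Kinf) => D hD DK nKD.
by apply: contrapT => nD; apply: nKD; apply: Kmin.
Qed.

Lemma lenle_cyc (M : lmodType T) :
  exists n, forall m : M, lenle n (@zerom T M) (cyc m).
Proof.
have [n hn] := artinian_finite_length; exists n => m.
have [g gE] := orbit_linear m.
apply: lenle_sub (lenle_image g (@submod_whole _ _) hn) => _ [a ->].
by exists a; rewrite ?gE.
Qed.

End Hopkins.

(** * The Harada-Sai lemma *)

Lemma linear_injective (T : pzRingType) (M N : lmodType T) (f : {linear M -> N}) :
  (forall x, f x = 0 -> x = 0) -> injective f.
Proof.
move=> h x y fxy; apply/eqP; rewrite -subr_eq0; apply/eqP/h.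
by rewrite linearB fxy subrr.
Qed.

Section HaradaSai.
Variables (T : pzRingType) (I : Type) (Y : I -> lmodType T) (b : nat).
Hypothesis indecY : forall i, indec (@whole (Y i)).
Hypothesis lenY : forall i, lenle b (@zerom T (Y i)) (@whole (Y i)).

Inductive path_of : nat -> forall i j, (Y i -> Y j) -> Prop :=
| path0 i : path_of 0 (@id (Y i))
| pathS n i j k (r : {linear Y j -> Y k}) (p : Y i -> Y j) :
    ~ bijective r -> path_of n p -> path_of n.+1 (r \o p).

Lemma path_linear n i j (p : Y i -> Y j) :
  path_of n p -> exists q : {linear Y i -> Y j}, p = q.
Proof.
elim=> {n i j p} [i|n i j k r p _ _ [q ->]]; first by exists idfun.
by exists (r \o q).
Qed.

Lemma path_pre n i j k (p : Y j -> Y k) (r : {linear Y i -> Y j}) :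
  ~ bijective r -> path_of n p -> path_of n.+1 (p \o r).
Proof.
move=> hr hp; elim: hp i r hr => {n j k p} [j i r hr|n u j k q p hq _ IH i r hr].
  exact: (pathS hr (path0 i)).
exact: (pathS hq (IH _ _ hr)).
Qed.

Lemma path_last n i j (p : Y i -> Y j) : path_of n p -> (0 < n)%N ->
  exists k (r : {linear Y k -> Y j}) q,
    [/\ ~ bijective r, path_of n.-1 (q : Y i -> Y k) & p = r \o q].
Proof. by case=> {n i j p} // n i j k r q hr hq _; exists j, r, q. Qed.

Lemma path_split a c i j (p : Y i -> Y j) : path_of (a + c) p ->
  exists k (p1 : Y i -> Y k) (p2 : Y k -> Y j),
    [/\ path_of a p1, path_of c p2 & p = p2 \o p1].
Proof.
elim: c j p => [|c IH] j p; first by rewrite addn0; exists j, p, id; split=> //; exact: path0.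
rewrite addnS => /path_last[//|k [r [q [hr hq ->]]]].
have [u [p1 [p2 [h1 h2 ->]]]] := IH _ _ hq.
by exists u, p1, (r \o p2); split=> //; apply: pathS.
Qed.

(** If the length does not drop, [h \o g] is injective on [range f] and the composite has the same
    range as [h]. Then [Y u = range f ⊕ ker (h g)] and [Y v = range (g f) ⊕ ker h];
    indecomposability kills both kernels unless the composite is zero, and [g] becomes bijective. *)
Lemma harada_sai_step m i u v j (f : {linear Y i -> Y u})
    (g : {linear Y u -> Y v}) (h : {linear Y v -> Y j}) :
  lenle m.+1 (@zerom _ _) (range f) -> lenle m.+1 (@zerom _ _) (range h) ->
  ~ bijective g -> lenle m (@zerom _ _) (range (h \o (g \o f))).
Proof.
move=> hf hh ng.
have [[_ [[x _ <-] fx0 hgf0]]|inj] :=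
    pselect (exists x, [/\ range f x, x <> 0 & h (g x) = 0]).
  have := @lenle_image_strict _ _ _ m (h \o g) _ (f x) (submod_range f).
  move=> /(_ _ hgf0 fx0 hf) hm; apply: lenle_sub (hm _); last by exists x.
  by move=> _ [z _ <-]; exists (f z) => //; exists z.
have [hsub|nsub] := pselect (range h `<=` range (h \o (g \o f))); last first.
  apply: hh => //; first exact: (submod_range (h \o (g \o f))).
    exact: (zerom_sub (submod_range (h \o (g \o f)))).
  by move=> _ [z _ <-]; exists (g (f z)).
have gfinj z : h (g (f z)) = 0 -> f z = 0.
  by move=> e; apply: contrapT => fz; apply: inj; exists (f z); split=> //; exists z.
have lift y : exists z, h y = h (g (f z)).
  by have [|z _ <-] := hsub (h y); [exists y|exists z].
have zero : (forall z, h (g (f z)) = 0) ->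
    lenle m (@zerom _ _) (range (h \o (g \o f))).
  by move=> e; apply: (@lenle_leq _ _ 0) => // _ [z _ <-]; apply: e.
have [_ [_ indu]] := indecY u.
have [||||||f0|hginj] := indu (range f) (kerm (h \o g)).
- exact: submod_range.
- exact: submod_ker.
- by [].
- by [].
- by move=> _ [z _ <-] /gfinj.
- move=> y _; have [z e] := lift (g y); exists (f z), (y - f z); split; first by exists z.
  split; last by rewrite addrC subrK.
  by rewrite /kerm /preimage /= /zerom !linearB e subrr.
- by apply: zero => z; rewrite (f0 (f z)) ?linear0 //; exists z.
have [_ [_ indv]] := indecY v.
have [||||||gf0|hinj] := indv (range (g \o f)) (kerm h).
- exact: submod_range.
- exact: submod_ker.
- by [].
- by [].
- by move=> _ [z _ <-] /gfinj /= ->; rewrite linear0.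
- move=> y _; have [z e] := lift y; exists (g (f z)), (y - g (f z)).
  split; first by exists z.
  split; last by rewrite addrC subrK.
  by rewrite /kerm /preimage /= /zerom linearB e subrr.
- by apply: zero => z; rewrite (gf0 (g (f z))) ?linear0 //; exists z.
case: ng; apply: inj_surj_bijective => [|y].
  apply: linear_injective => x gx0; apply: hginj.
  by rewrite /kerm /preimage /= /zerom gx0 linear0.
have [z e] := lift y; exists (f z); apply: (linear_injective hinj).
by rewrite e.
Qed.

(** Closed form [2^k - 1]. The recursion mirrors the cut of a path into two halves around one middle
    map. *)
Fixpoint harada_sai_bound k :=
  if k is k'.+1 then ((harada_sai_bound k').+1 + harada_sai_bound k')%N else 0%N.

Lemma path_range k m i j (p : Y i -> Y j) : (k + m)%N = b ->
  path_of (harada_sai_bound k) p -> lenle m (@zerom _ _) (range p).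
Proof.
elim: k m i j p => [|k IH] m i j p.
  by rewrite add0n => -> _; apply: lenle_sub (lenY j).
(* The successor in the bound is the middle non-isomorphism [g]; both halves have range of length at
   most [m.+1], and [g] forces the drop to [m]. *)
rewrite addSnnS => km /= /path_split[v [q [h [hq hh ->]]]].
have {hq}[//|u [g [f [ng hf ->]]]] := path_last hq.
have := IH _ _ _ _ km hf; have := IH _ _ _ _ km hh.
have [h' ->] := path_linear hh; have [f' ->] := path_linear hf.
by move=> lh lf; apply: harada_sai_step.
Qed.

Theorem harada_sai i j (p : Y i -> Y j) :
  path_of (harada_sai_bound b) p -> forall y, p y = 0.
Proof. by move=> /(path_range (addn0 b)) h y; apply: h; exists y. Qed.

End HaradaSai.

(** * Maximal families independent modulo the radical *)

Lemma sum_uniq_sub (V : nmodType) (E : eqType) (s s' : seq E) (F : E -> V) :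
  uniq s -> uniq s' -> {subset s <= s'} -> (forall a, a \notin s -> F a = 0) ->
  \sum_(a <- s') F a = \sum_(a <- s) F a.
Proof.
move=> us us' ss' F0; rewrite (bigID (mem s)) /= addrC big1 ?add0r; last first.
  by move=> a /F0.
rewrite -big_filter; apply/perm_big/uniq_perm; rewrite ?filter_uniq //.
by move=> a; rewrite mem_filter /=; case: (boolP (a \in s)) => //= /ss'.
Qed.

Section Span.
Variables (T : pzRingType) (I : Type) (Y : I -> lmodType T) (X : lmodType T).

Definition map_to : Type := {i : I & {linear Y i -> X}}.
HB.instance Definition _ := gen_eqMixin map_to.

Definition dom (a : map_to) : lmodType T := Y (tag a).
Definition app (a : map_to) : {linear dom a -> X} := tagged a.

(** A Kronecker delta between dependent types: the identity makes sense only along an equality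
    [a = c], hence the cast, stated for every proof of that equality. *)
Lemma delta_key (a c : map_to) : exists d : {linear dom a -> dom c},
  (a <> c -> forall x, d x = 0) /\
  forall e : a = c, forall x, d x = ecast z (dom z) e x.
Proof.
have [e|ne] := pselect (a = c).
  subst c; exists idfun; split=> // e x.
  by rewrite (Prop_irrelevance e erefl).
by exists (\0 : {linear dom a -> dom c}); split=> // e; case: ne.
Qed.

Definition delta a c : {linear dom a -> dom c} :=
  sval (cid (delta_key a c)).

Lemma delta_id a x : delta a a x = x.
Proof.
by have [_ /(_ erefl)] := svalP (cid (delta_key a a)); apply.
Qed.

Lemma delta_neq a c x : a != c -> delta a c x = 0.
Proof.
by move=> /eqP ac; have [/(_ ac) + _] := svalP (cid (delta_key a c)); apply.
Qed.

Lemma sum_app_delta s a x : uniq s -> a \in s ->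
  \sum_(c <- s) app c (delta a c x) = app a x.
Proof.
move=> us sa; rewrite (bigD1_seq a) //= delta_id big1 ?addr0 // => c ca.
by rewrite delta_neq ?linear0 // eq_sym.
Qed.

Lemma sum_delta s c (x : forall a, dom a) : uniq s -> c \in s ->
  \sum_(a <- s) delta a c (x a) = x c.
Proof.
move=> us sc; rewrite (bigD1_seq c) //= delta_id big1 ?addr0 // => a ac.
by rewrite delta_neq.
Qed.

Variable A : map_to -> Prop.

(** Coefficients are total in [a] and vanish off [s], so two combinations can be added over the
    union of their lists. *)
Definition in_span (Z : lmodType T) (phi : Z -> X) :=
  exists (s : seq map_to) (h : forall a, {linear Z -> dom a}),
    [/\ uniq s, forall a, a \in s -> A a, forall a z, a \notin s -> h a z = 0 &
        forall z, phi z = \sum_(a <- s) app a (h a z)].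

Lemma in_span0 (Z : lmodType T) : in_span (fun _ : Z => 0).
Proof.
exists [::], (fun a => \0 : {linear Z -> dom a}).
by split=> // z; rewrite big_nil.
Qed.

Lemma in_span_comp (Z W : lmodType T) (phi : Z -> X) (u : {linear W -> Z}) :
  in_span phi -> in_span (phi \o u).
Proof.
move=> [s [h [us sA h0 hE]]]; exists s, (fun a => h a \o u : {linear W -> dom a}).
by split=> // [a z /= /h0|z /=]; rewrite ?hE.
Qed.

Lemma in_spanD (Z : lmodType T) (phi psi : Z -> X) :
  in_span phi -> in_span psi -> in_span (fun z => phi z + psi z).
Proof.
move=> [s [h [us sA h0 hE]]] [s' [h' [us' sA' h0' hE']]].
exists (undup (s ++ s')), (fun a => h a \+ h' a : {linear Z -> dom a}); split.
- exact: undup_uniq.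
- by move=> a; rewrite mem_undup mem_cat => /orP[/sA|/sA'].
- move=> a z /=; rewrite mem_undup mem_cat negb_or => /andP[/h0 -> /h0' ->].
  by rewrite addr0.
move=> z; under eq_bigr do rewrite /= linearD; rewrite big_split /= hE hE'.
have us2 := undup_uniq (s ++ s').
congr (_ + _); apply/esym/sum_uniq_sub => //.
- by move=> a sa; rewrite mem_undup mem_cat sa.
- by move=> a /h0 ->; rewrite linear0.
- by move=> a sa; rewrite mem_undup mem_cat sa orbT.
- by move=> a /h0' ->; rewrite linear0.
Qed.

Lemma in_span_app a : A a -> in_span (app a).
Proof.
move=> Aa; exists [:: a], (fun c => delta a c); split=> //.
- by move=> c; rewrite inE => /eqP ->.
- by move=> c z; rewrite inE eq_sym => /delta_neq.
- by move=> z; rewrite big_seq1 delta_id.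
Qed.

(** The radical of [Hom (-, X)] at [Y j]: finite sums of maps factoring through a non-isomorphism
    from [Y j] to some [Y k]. *)
Inductive in_rad j : (Y j -> X) -> Prop :=
| in_rad0 : in_rad (fun _ => 0)
| in_radD phi k (r : {linear Y j -> Y k}) (g : {linear Y k -> X}) :
    ~ bijective r -> in_rad phi -> in_rad (fun y => phi y + g (r y)).

Lemma in_rad_comp i j (phi : Y j -> X) (u : {linear Y i -> Y j}) :
  bijective u -> in_rad phi -> in_rad (phi \o u).
Proof.
move=> bu; elim=> {phi} [|phi k r g nr _ IH]; first exact: in_rad0.
apply: (@in_radD i (phi \o u) k (r \o u) g) => // bru; apply: nr.
have [v uv vu] := bu.
apply: (eq_bij (f := (r \o u) \o v)); last by move=> y /=; rewrite vu.
by apply: bij_comp => //; exists u.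
Qed.

(* The maps in [A] are linearly independent over the division rings
   [End (Y i) / rad] in [Hom (-, X)] modulo its radical. *)
Definition rad_indep := forall s j (h : forall a, {linear Y j -> dom a}),
  uniq s -> (forall a, a \in s -> A a) ->
  in_rad (fun y => \sum_(a <- s) app a (h a y)) ->
  forall a, a \in s -> ~ bijective (h a).

End Span.

Section MaximalFamily.
Variables (T : pzRingType) (I : Type) (Y : I -> lmodType T) (X : lmodType T).
Notation map_to := (map_to Y X).

Lemma ex_maximal_rad_indep : exists A : map_to -> Prop, rad_indep A /\
  forall t, ~ A t -> ~ rad_indep (fun a => A a \/ a = t).
Proof.
have [F Find Ftot|A [Aind Amax]] := @Zorn_bigcup map_to (fun A => rad_indep A).
  move=> s j h us sF hrad a sa.
  (* A finite list from the union lies in one member of the chain; the empty list stands apart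
     because the chain may be empty. *)
  suff [s0|[G FG sG]] : s = [::] \/ exists2 G, F G & forall c, c \in s -> G c.
  - by move: sa; rewrite s0.
  - exact: (Find G FG s j h us sG hrad a sa).
  elim: s sF {us hrad sa} => [|c s IH] sF; [by left|right].
  have [H' FH' H'c] := sF c (mem_head c s).
  have [d sd|->|[H FH sH]] := IH; first by apply: sF; rewrite inE sd orbT.
    by exists H' => // d; rewrite inE => /eqP ->.
  have [HH|HH] := Ftot _ _ FH FH'; [exists H'|exists H] => // d;
    rewrite inE => /orP[/eqP ->|/sH]; by [|exact: HH].
exists A; split=> // t nAt; apply: Amax; split=> [a|h]; first by left.
by apply/nAt/h; right.
Qed.

Variable A : map_to -> Prop.
Hypothesis Aind : rad_indep A.
Hypothesis Amax : forall t, ~ A t -> ~ rad_indep (fun a => A a \/ a = t).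

(** By maximality, adding [t] creates a relation in the radical with some bijective coefficient, and
    [t] occurs in it. If the coefficient of [t] is bijective, solve for [app t]. Otherwise the term
    of [t] is itself radical, and the rest contradicts the independence of [A]. *)
Lemma in_span_rad (t : map_to) : exists sigma rho : dom t -> X,
  [/\ in_span A sigma, @in_rad _ _ Y X (tag t) rho & forall y, app t y = sigma y + rho y].
Proof.
have [At|nAt] := pselect (A t).
  exists (app t), (fun _ => 0); split; [exact: in_span_app|exact: in_rad0|].
  by move=> y; rewrite addr0.
have := Amax nAt => /existsNP[s] /existsNP[j] /existsNP[h].
move=> /not_implyP[us] /not_implyP[sA] /not_implyP[hrad].
move=> /existsNP[a] /not_implyP[sa] /contrapT ha.
have [ts|nts] := boolP (t \in s); last first.
  exfalso; apply: (Aind us _ hrad sa ha) => c sc.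
  by have [//|ct] := sA c sc; move: nts; rewrite -ct sc.
have rA c : c \in rem t s -> A c.
  rewrite mem_rem_uniq // inE => /andP[ct /sA[//|]]; by move/eqP: ct.
have sumE y : \sum_(c <- s) app c (h c y) =
    app t (h t y) + \sum_(c <- rem t s) app c (h c y).
  by rewrite (perm_big _ (perm_to_rem ts)) big_cons.
have [ht|nht] := pselect (bijective (h t)).
  have [g [hK gK]] := linear_inverse ht.
  pose h' c : {linear Y j -> dom c} :=
    if c \in rem t s then (\- h c : {linear _ -> _}) else (\0 : {linear _ -> _}).
  exists ((fun y => \sum_(c <- rem t s) app c (h' c y)) \o g),
    ((fun y => \sum_(c <- s) app c (h c y)) \o g); split.
  - apply: in_span_comp; exists (rem t s), h'; split=> //.
      exact: rem_uniq.
    by move=> c z nc; rewrite /h' (negbTE nc).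
  - by apply: in_rad_comp => //; exists (h t).
  - move=> y /=; rewrite sumE gK addrCA -big_split /= big_seq big1 ?addr0 //.
    by move=> c cs; rewrite /h' cs /= linearN addNr.
have hrad' : in_rad (fun y => \sum_(c <- rem t s) app c (h c y)).
  have := @in_radD _ _ _ X j _ (tag t) (h t) (\- app t) nht hrad; congr in_rad; apply/funext => y /=.
  by rewrite sumE addrC addKr.
have [at_|nat_] := eqVneq a t; first by case: nht; rewrite -at_.
exfalso; apply: (Aind (rem_uniq t us) rA hrad' _ ha).
by rewrite mem_rem_uniq // inE nat_ sa.
Qed.

Variable N : nat.
Hypothesis pathN0 : forall i j (p : Y i -> Y j), path_of N p -> forall y, p y = 0.

(** Each use of [in_span_rad] replaces [g] by a span term plus terms [g' \o r] with [r] a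
    non-isomorphism. The path [p] collects these [r], and after [N] rounds it is zero. *)
Lemma in_span_all i (f : {linear Y i -> X}) : in_span A f.
Proof.
have key n m j k (p : Y j -> Y k) (g : {linear Y k -> X}) :
    (n + m)%N = N -> path_of m p -> in_span A (g \o p).
  elim: n m k p g => [|n IH] m k p g.
    rewrite add0n => mN; rewrite mN => /pathN0 p0.
    have -> : g \o p = fun _ => 0 by apply/funext => y /=; rewrite p0 linear0.
    exact: in_span0.
  rewrite addSnnS => nm hp.
  have [sigma [rho [hs hr E]]] := in_span_rad (existT _ k g).
  have -> : g \o p = fun y => (sigma \o p) y + (rho \o p) y.
    by apply/funext => y; apply: E.
  apply: in_spanD.
    by have [p' ->] := path_linear hp; apply: in_span_comp.
  elim: hr => [|phi c r g' nr _ IHr]; first exact: in_span0.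
  apply: (in_spanD IHr); apply: (IH _ _ (r \o p) g' nm); exact: pathS.
exact: (key N 0%N i i id f (addn0 N) (path0 Y i)).
Qed.

End MaximalFamily.

(** * The decomposition *)

Section DirectSum.
Variables (T : pzRingType) (S : lmodType T -> Prop).
Hypothesis dccT : dcc (@left_ideal T).
Hypothesis S_sub : forall M : lmodType T, S M ->
  forall P : M -> Prop, submod P -> inS S P.
Variables (I : Type) (Y : I -> lmodType T) (b : nat).
Hypothesis indecY : forall i, indec (@whole (Y i)).
Hypothesis lenY : forall i, lenle b (@zerom T (Y i)) (@whole (Y i)).
Hypothesis Y_repr : forall Z : lmodType T, S Z -> indec (@whole Z) ->
  finlen (@whole Z) -> exists i, mod_iso Z (Y i).

Lemma submod_object (M : lmodType T) (P : M -> Prop) : S M -> submod P ->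
  exists (Z : lmodType T) (u : {linear Z -> M}),
    [/\ S Z, injective u & forall m, P m <-> exists z, u z = m].
Proof.
move=> SM hP; have [Z [f [SZ [/linear_of_lin_fun[u ->] [uinj uP]]]]] := S_sub SM hP.
by exists Z, u.
Qed.

Lemma lenle_object (M Z : lmodType T) (P : M -> Prop) (u : {linear Z -> M}) n :
  injective u -> (forall m, P m <-> exists z, u z = m) ->
  lenle n (@zerom T M) P -> lenle n (@zerom T Z) (@whole Z).
Proof.
move=> uinj uP h; apply: (lenle_whole_inj uinj); apply: lenle_sub h.
by move=> _ [z _ <-]; apply/uP; exists z.
Qed.

Lemma indec_range (M Z : lmodType T) (u : {linear Z -> M}) : injective u ->
  indec (@whole Z) -> indec (range u).
Proof.
move=> uinj [_ [[z [_ z0]] ind]]; split; first exact: submod_range.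
split.
  exists (u z); split; first by exists z.
  by rewrite -(linear0 u) => /uinj.
move=> A B hA hB AR BR AB0 ABR.
have [||||||A0|B0] := ind (u @^-1` A) (u @^-1` B).
- exact: submod_preimage.
- exact: submod_preimage.
- by [].
- by [].
- by move=> y Ay By; apply: uinj; rewrite linear0; apply: AB0.
- move=> y _; have [|a [c [Aa [Bc e]]]] := ABR (u y); first by exists y.
  have [ya _ ea] := AR _ Aa; have [yc _ ec] := BR _ Bc.
  exists ya, yc; rewrite /preimage /= ea ec; split=> //; split=> //.
  by apply: uinj; rewrite linearD ea ec.
- by left=> m Am; have [y _ e] := AR _ Am; rewrite -e (A0 y) ?linear0 // /preimage /= e.
- by right=> m Bm; have [y _ e] := BR _ Bm; rewrite -e (B0 y) ?linear0 // /preimage /= e.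
Qed.

Variable X : lmodType T.
Hypothesis SX : S X.
Variable A : map_to Y X -> Prop.
Hypothesis Aind : rad_indep A.
Hypothesis Aspan : forall i (f : {linear Y i -> X}), in_span A f.

(** Induction on length: an indecomposable [Z] is isomorphic to some [Y i]; otherwise [Z] splits
    into two shorter objects of [S], and [u] is the sum of its restrictions composed with the
    projections. *)
Lemma in_span_finlen n (Z : lmodType T) (u : {linear Z -> X}) : S Z ->
  lenle n (@zerom T Z) (@whole Z) -> in_span A u.
Proof.
elim: n Z u => [|n IH] Z u SZ hn.
  have -> : (u : Z -> X) = fun _ => 0.
    apply/funext => z; have -> : z = 0 by apply: hn.
    by rewrite linear0.
  exact: in_span0.
have [Z0|nZ0] := pselect (@whole Z `<=` @zerom T Z).
  by apply: IH => //; apply: (@lenle_leq _ _ 0).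
have [indZ|nind] := pselect (indec (@whole Z)).
  have [i [f [/linear_of_lin_fun[v ->] vbij]]] :=
    Y_repr SZ indZ (finlen_of_lenle (@submod_whole _ _) hn).
  have [w [vK wK]] := linear_inverse vbij.
  have -> : (u : Z -> X) = (u \o w) \o v by apply/funext => z /=; rewrite vK.
  exact/in_span_comp/Aspan.
have [C [D [hC hD CD0 CDZ [nC0 nD0]]]] : exists C D : Z -> Prop,
    [/\ submod C, submod D, forall m, C m -> D m -> m = 0,
        forall m, exists c d, [/\ C c, D d & m = c + d] &
        ~ (C `<=` @zerom T Z) /\ ~ (D `<=` @zerom T Z)].
  apply: contrapT => h; apply: nind; split=> //; split.
    by have [z [_ z0]] := (not_subP _ _).1 nZ0; exists z.
  move=> C D hC hD _ _ CD0 CDZ; apply: contrapT => /not_orP[nC nD]; apply: h.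
  exists C, D; split=> // m; have [c [d [Cc [Dd e]]]] := CDZ m Logic.I.
  by exists c, d.
have len_summand (P Q : Z -> Prop) : submod P -> (forall m, P m -> Q m -> m = 0) ->
    ~ (Q `<=` @zerom T Z) -> lenle n (@zerom T Z) P.
  move=> hP PQ0 nQ; apply: hn => //; first exact: zerom_sub.
  by move=> hZ; apply: nQ => z Qz; apply: PQ0 => //; apply: hZ.
have [ZC [uC [SC uCinj uCP]]] := submod_object SZ hC.
have [ZD [uD [SD uDinj uDP]]] := submod_object SZ hD.
have lC : lenle n (@zerom T ZC) (@whole ZC).
  by apply: lenle_object uCinj uCP _; apply: len_summand hC CD0 nD0.
have lD : lenle n (@zerom T ZD) (@whole ZD).
  apply: lenle_object uDinj uDP _; apply: len_summand hD _ nC0 => m Dm Cm.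
  exact: CD0.
have uniq_dec c1 d1 c2 d2 : uC c1 + uD d1 = uC c2 + uD d2 -> c1 = c2 /\ d1 = d2.
  move=> e; have e' : uC (c1 - c2) = uD (d2 - d1).
    by rewrite !linearB; apply/eqP; rewrite subr_eq addrAC -subr_eq opprK e addrC.
  have z : uC (c1 - c2) = 0.
    by apply: CD0; [apply/uCP|rewrite e'; apply/uDP]; eexists.
  split; apply/eqP; rewrite -subr_eq0; apply/eqP.
    by apply: uCinj; rewrite z linear0.
  by apply: uDinj; apply: oppr_inj; rewrite -linearN opprB -e' z linear0 oppr0.
have dec z : exists c d, z = uC c + uD d.
  have [_ [_ [/uCP[c <-] /uDP[d <-] ->]]] := CDZ z.
  by exists c, d.
have [|||pC pCE] := @linear_of_rel _ Z ZC (fun z c => exists d, z = uC c + uD d).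
- by [].
- by move=> z c c' [d ->] [d' /uniq_dec[]].
- move=> a z z' c c' [d ->] [d' ->]; exists (a *: d + d').
  by rewrite !linearP scalerDr addrACA.
have [|||pD pDE] := @linear_of_rel _ Z ZD (fun z d => exists c, z = uC c + uD d).
- by move=> z; have [c [d ->]] := dec z; exists d, c.
- by move=> z d d' [c ->] [c' /uniq_dec[]].
- move=> a z z' d d' [c ->] [c' ->]; exists (a *: c + c').
  by rewrite !linearP scalerDr addrACA.
have -> : (u : Z -> X) = fun z => ((u \o uC) \o pC) z + ((u \o uD) \o pD) z.
  apply/funext => z /=; rewrite -linearD.
  have [d e] := pCE z; have [c e'] := pDE z.
  by have /uniq_dec[_ dE] := etrans (esym e) e'; rewrite {1}e dE.
by apply: in_spanD; apply: in_span_comp; apply: IH.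
Qed.

Lemma sum_ranges_len (s : seq (map_to Y X)) : exists (P : X -> Prop) n,
  [/\ submod P, lenle n (@zerom T X) P &
      forall a, a \in s -> range (app a) `<=` P].
Proof.
elim: s => [|a s [P [n [hP hn sP]]]].
  by exists (@zerom T X), 0%N; split=> //; exact: submod_zero.
have hR := submod_range (app a).
exists (addm (range (app a)) P), (n + b)%N; split.
- exact: submod_addm.
- apply: lenle_addm => //; apply: lenle_image; [exact: submod_whole|exact: lenY].
- move=> c; rewrite inE => /orP[/eqP ->|/sP cP]; first exact: addml.
  by apply: subset_trans cP (addmr hR).
Qed.

Variable N : nat.
Hypothesis pathN0 : forall i j (p : Y i -> Y j), path_of N p -> forall y, p y = 0.

(* Expressing each [app a], [a \in s], once trivially and once through the
   family [A] after factoring it over a finite-length object gives a relation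
   [x = k x] where all entries of the matrix [k] are non-isomorphisms. *)
Lemma sum_app_inj (s : seq (map_to Y X)) (x : forall a : map_to Y X, dom a) :
  uniq s -> (forall a, a \in s -> A a) ->
  \sum_(a <- s) app a (x a) = 0 -> forall a, a \in s -> x a = 0.
Proof.
move=> us sA sum0.
have [P [n [hP hn sP]]] := sum_ranges_len s.
have [Z [u [SZ uinj uP]]] := submod_object SX hP.
have [s' [q [us' sA' q0 uE]]] := in_span_finlen u SZ (lenle_object uinj uP hn).
have factor a : exists g : {linear dom a -> Z},
    a \in s -> forall y, u (g y) = app a y.
  have [sa|_] := boolP (a \in s); last by exists \0.
  have [|g gE] := @linear_factor _ _ _ _ u (app a) uinj; last by exists g.
  by move=> y; apply/uP; apply: sP sa _ _; exists y.
pose g a := sval (cid (factor a)).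
have gE a : a \in s -> forall y, u (g a y) = app a y by exact: svalP (cid (factor a)).
pose k a c : {linear dom a -> dom c} := delta a c \- (q c \o g a).
pose s2 := undup (s ++ s').
have us2 : uniq s2 by exact: undup_uniq.
have ss2 : {subset s <= s2} by move=> a sa; rewrite mem_undup mem_cat sa.
have ss2' : {subset s' <= s2} by move=> a sa; rewrite mem_undup mem_cat sa orbT.
have s2A a : a \in s2 -> A a.
  by rewrite mem_undup mem_cat => /orP[/sA|/sA'].
(* Row relation: summing [app d \o k a d] over [d] gives [app a - u \o g a = 0], so [rad_indep]
   applies to the row of [a]. *)
have k_noniso a c : a \in s -> c \in s -> ~ bijective (k a c).
  move=> sa sc; apply: (Aind us2 s2A _ (ss2 _ sc)).
  have -> : (fun y => \sum_(d <- s2) app d (k a d y)) = fun _ => 0.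
    apply/funext => y; under eq_bigr do rewrite /= linearB.
    rewrite sumrB sum_app_delta ?ss2 //.
    rewrite (@sum_uniq_sub _ _ s' s2) // => [|d sd]; last by rewrite q0 ?linear0.
    by rewrite -uE gE // subrr.
  exact: in_rad0.
(* Column relation: the correction term is [q a] at the sum of the [g c (x c)], which is zero since
   the injective [u] sends it to the given vanishing sum. *)
have xE a : a \in s -> x a = \sum_(c <- s) k c a (x c).
  move=> sa; rewrite sumrB (sum_delta x) //= -linear_sum.
  have -> : \sum_(c <- s) g c (x c) = 0; last by rewrite linear0 subr0.
  apply: uinj; rewrite linear0 linear_sum -[RHS]sum0 big_seq [RHS]big_seq.
  by apply: eq_bigr => c sc; rewrite gE.
(* Substituting [x = k x] under [p] lengthens the path by one non-isomorphism; at length [N] it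
   vanishes. The case [m = 0], [p = id] is the claim. *)
have key r m a j (p : dom a -> Y j) : (r + m)%N = N -> a \in s ->
    @path_of _ _ Y m (tag a) j p -> p (x a) = 0.
  elim: r m a p => [|r IH] m a p.
    by rewrite add0n => -> _ /pathN0; apply.
  rewrite addSnnS => rm sa hp; rewrite xE //.
  have [p' pE] := path_linear hp; rewrite pE linear_sum big_seq big1 // => c sc.
  rewrite -pE; apply: (IH _ _ (p \o k c a) rm sc).
  exact: (@path_pre _ _ Y m (tag c) (tag a) j p (k c a) (k_noniso _ _ sc sa) hp).
by move=> a sa; apply: (key N 0%N a (tag a) id (addn0 N) sa (path0 Y (tag a))).
Qed.

Lemma app_inj a : A a -> injective (app a).
Proof.
move=> Aa; apply: linear_injective => y ay0.
rewrite -[y]delta_id; apply: (@sum_app_inj [:: a] (fun c => delta a c y)) => //.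
- by move=> c; rewrite inE => /eqP ->.
- by rewrite big_seq1 delta_id.
- exact: mem_head.
Qed.

Let J := {a : map_to Y X | A a}.
Let summand (i : J) : X -> Prop := range (app (sval i)).

(* The sum is evaluated through the linear maps [c |-> c *: x] from the regular
   module, for which [in_span] collects the terms with equal index. *)
Lemma sumfam_span (Q : J -> Prop) m : sumfam summand Q m ->
  exists (s : seq (map_to Y X)) (x : forall a : map_to Y X, dom a),
    [/\ uniq s, forall a, a \in s -> exists2 i, Q i & sval i = a,
        forall a, a \notin s -> x a = 0 & m = \sum_(a <- s) app a (x a)].
Proof.
move=> [l [x [lQ ->]]].
have : in_span (fun a => exists2 i, Q i & sval i = a)
    (fun c : T^o => (c : T) *: (\sum_(j <- l) x j : X)).
  elim: l lQ => [|j l IH] lQ.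
    rewrite big_nil.
    have -> : (fun c : T^o => (c : T) *: (0 : X)) = fun _ => 0.
      by apply/funext => c; rewrite scaler0.
    exact: in_span0.
  have [Qj [y _ yE]] := lQ j (or_introl erefl).
  have [g gE] := orbit_linear y.
  have -> : (fun c : T^o => (c : T) *: (\sum_(j <- j :: l) x j : X)) =
      fun c => (app (sval j) \o g) c + (c : T) *: (\sum_(j <- l) x j : X).
    by apply/funext => c; rewrite big_cons scalerDr /= gE linearZ yE.
  apply: in_spanD; last by apply: IH => d dl; apply: lQ; right.
  by apply: in_span_comp; apply: in_span_app; exists j.
move=> [s [h [us sA h0 /(_ 1) hE]]]; exists s, (fun a => h a 1); split=> //.
  by move=> a; apply: h0.
by rewrite -hE scale1r.
Qed.

Lemma indep_summand : indep summand.
Proof.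
move=> i m [y _ <-] /sumfam_span[s [x [us sQ x0 mE]]].
have nis : sval i \notin s.
  by apply/negP => /sQ[j ji] /(@eq_sig_hprop _ A (fun _ => @Prop_irrelevance _) j i).
have usi : uniq (sval i :: s) by rewrite /= nis.
(* Moves the expansion of [m] to the other side: [y] becomes the coefficient at [sval i] of a single
   vanishing combination. *)
have -> : y = delta (sval i) (sval i) y - x (sval i).
  by rewrite delta_id x0 // subr0.
rewrite (sum_app_inj (x := fun a => delta (sval i) a y - x a) usi) ?linear0 //.
- move=> a; rewrite inE => /orP[/eqP ->|/sQ[j _ <-]]; exact: svalP.
- under eq_bigr do rewrite linearB.
  rewrite sumrB sum_app_delta ?mem_head // big_cons (x0 _ nis) linear0 add0r.
  by rewrite -mE subrr.
- exact: mem_head.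
Qed.

(** The cyclic submodule of [m] has finite length over an artinian ring, so its inclusion into [X]
    lies in the span of [A]; evaluate at the point above [m]. *)
Lemma sumfam_summand m : sumfam summand (@whole J) m.
Proof.
have [n hn] := lenle_cyc dccT X.
have [Z [u [SZ uinj uP]]] := submod_object SX (submod_cyc m).
have [s [h [us sA _ uE]]] := in_span_finlen u SZ (lenle_object uinj uP (hn m)).
have [z <-] := (uP m).1 (cyc_id m).
rewrite uE {uE us}.
suff [l <-] : exists l : seq J, [seq sval j | j <- l] = s.
  exists l, (fun j => app (sval j) (h (sval j) z)); rewrite big_map; split=> //.
  by move=> j _; split=> //; exists (h (sval j) z).
elim: s sA => [|a s IH] sA; first by exists [::].
have [|l <-] := IH; first by move=> c cs; apply: sA; rewrite inE cs orbT.
by exists (exist _ a (sA a (mem_head a s)) :: l).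
Qed.

Lemma direct_sum_decomposition : exists (K : Type) (P : K -> X -> Prop),
  [/\ forall i, finlen (P i), forall i, fingen (P i) /\ indec (P i), indep P &
      forall m, sumfam P (@whole K) m].
Proof.
have len_summand i : lenle b (@zerom T X) (summand i).
  by apply: lenle_image => //; apply: lenY.
have sub_summand i : submod (summand i) by exact: submod_range.
exists J, summand; split.
- by move=> i; apply: finlen_of_lenle.
- move=> i; split; first exact: fingen_of_lenle.
  by apply: indec_range; [apply: app_inj; exact: svalP|exact: indecY].
- exact: indep_summand.
- exact: sumfam_summand.
Qed.

End DirectSum.

(** * Indecomposable objects and the list of representatives *)

Lemma sumfam_add1 (T : pzRingType) (X : lmodType T) (K : Type)
    (P : K -> X -> Prop) (Q : K -> Prop) j m y : (forall i, submod (P i)) ->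
  Q j -> P j y -> sumfam P Q m -> sumfam P Q (y + m).
Proof.
move=> hP Qj Pjy [s [x [sQ ->]]].
(* A sum in [sumfam] has one value per index but may repeat indices. All occurrences of [j] are
   therefore merged into one before [y] is added. *)
pose rest s := [seq k <- s | `[< k <> j >]].
have [z Pjz zE] : exists2 z, P j z &
    \sum_(k <- s) x k = z + \sum_(k <- rest s) x k.
  elim: s sQ => [|k s IH] sQ.
    by exists 0; [case: (hP j)|rewrite /rest /= !big_nil addr0].
  have [z Pjz zE] := IH (fun c cs => sQ c (or_intror cs)).
  have [_ Pk] := sQ k (or_introl erefl).
  rewrite /rest /= big_cons zE; case: asboolP => [kj|/contrapT kj].
    by exists z => //; rewrite big_cons addrCA.
  by exists (x k + z); [apply: submodD => //; rewrite -kj|rewrite addrA].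
exists (j :: rest s), (fun k => if `[< k <> j >] then x k else y + z).
split=> [k [<-|]|].
- by split=> //; case: asboolP => // _; apply: submodD.
- move=> /List.filter_In[/sQ[Qk Pk]]; by case: asboolP.
rewrite big_cons zE addrA; congr (_ + _); first by case: asboolP.
rewrite /rest !big_filter; apply: eq_bigr => k.
by case: asboolP.
Qed.

Lemma submod_sumfam (T : pzRingType) (X : lmodType T) (K : Type)
    (P : K -> X -> Prop) (Q : K -> Prop) :
  (forall i, submod (P i)) -> submod (sumfam P Q).
Proof.
move=> hP; split; first by exists [::], (fun _ => 0); rewrite big_nil.
move=> a _ y [s [x [sQ ->]]] Qy; rewrite scaler_sumr.
elim: s sQ => [|j s IH] sQ; first by rewrite big_nil add0r.
have [Qj Pj] := sQ j (or_introl erefl); rewrite big_cons -addrA.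
apply: (sumfam_add1 hP Qj); first exact: submodZ.
by apply: IH => k ks; apply: sQ; right.
Qed.

(** Since [X] is nonzero, some [P i] exists, and it is nonzero; the sum of the others is a
    complement, hence zero, and [X = P i]. *)
Lemma finlen_of_decomposition (T : pzRingType) (X : lmodType T) (K : Type)
    (P : K -> X -> Prop) : indec (@whole X) ->
  (forall i, finlen (P i)) -> (forall i, indec (P i)) -> indep P ->
  (forall m, sumfam P (@whole K) m) -> finlen (@whole X).
Proof.
move=> [_ [[x [_ x0]] indX]] Pfin Pind Pindep Psum.
have [i] : exists i : K, True.
  have [[|i l] [y [_ xE]]] := Psum x; last by exists i.
  by case: x0; rewrite xE big_nil.
move=> _.
have [hPi [[y [Piy y0]] _]] := Pind i.
have hrest : submod (sumfam P (fun j => j <> i)).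
  by apply: submod_sumfam => j; case: (Pfin j).
have [||||||Pi0|rest0] := indX (P i) (sumfam P (fun j => j <> i)) => //.
- exact: Pindep.
- move=> m _; have [l [z [lP ->]]] := Psum m.
  elim: l lP => [|j l IH] lP.
    exists 0, 0; rewrite big_nil addr0; split; first by case: hPi.
    by split=> //; case: hrest.
  have [|a [c [Pa [Rc e]]]] := IH; first by move=> k kl; apply: lP; right.
  have [_ Pj] := lP j (or_introl erefl); rewrite big_cons e.
  have [ji|ji] := pselect (j = i).
    exists (z j + a), c; rewrite addrA; split=> //; apply: submodD => //.
    by rewrite -ji.
  exists a, (z j + c); rewrite addrCA; split=> //; split=> //.
  apply: submodD => //; exists [:: j], z; rewrite big_seq1.
  by split=> // k [<-|].
- by case: y0; apply: Pi0.
suff -> : @whole X = P i by [].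
apply/seteqP; split=> // m _; have [l [z [lP ->]]] := Psum m.
apply: submod_sum => // j jl; have [_ Pj] := lP j jl.
have [<-//|ji] := pselect (j = i).
have -> : z j = 0; last by case: hPi.
by apply: rest0; exists [:: j], z; rewrite big_seq1; split=> // k [<-|].
Qed.

Lemma uniform_length (T : pzRingType) (d : lmodType T) (L : seq (lmodType T)) :
  exists b, forall i, (i < size L)%N -> finlen (@whole (nth d L i)) ->
    lenle b (@zerom T _) (@whole (nth d L i)).
Proof.
elim: L => [|Z L [b hb]]; first by exists 0%N.
have [[n hn]|nZ] := pselect (exists n, lenle n (@zerom T Z) (@whole Z)).
  exists (maxn n b) => -[_ _|i]; first exact: lenle_leq (leq_maxl _ _) hn.
  by rewrite ltnS => /hb h /h; apply: lenle_leq (leq_maxr _ _).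
exists b => -[_ /lenle_of_finlen //|i]; rewrite ltnS; exact: hb.
Qed.

Lemma In_nth (E : Type) (d x : E) (l : seq E) :
  List.In x l -> exists2 i, (i < size l)%N & nth d l i = x.
Proof.
elim: l => // y l IH [->|/IH[i il <-]]; first by exists 0%N.
by exists i.+1.
Qed.

Lemma mod_iso_indec_finlen (T : pzRingType) (Z W : lmodType T) : mod_iso Z W ->
  indec (@whole Z) -> finlen (@whole Z) -> indec (@whole W) /\ finlen (@whole W).
Proof.
move=> [f [/linear_of_lin_fun[u ->] [v uv vu]]] indZ /lenle_of_finlen[n hn].
have <- : range u = @whole W by apply/seteqP; split=> // y _; exists (v y).
split; first exact: (indec_range (can_inj uv)).
apply: (@finlen_of_lenle _ _ n); first exact: submod_range.
by apply: lenle_image.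
Qed.

Theorem theorem1 (R : pzRingType) (S : lmodType R^c -> Prop) :
  artinian_ring R ->
  (* closed under submodules *)
  (forall M : lmodType R^c, S M -> forall P : M -> Prop, submod P -> inS S P) ->
  (* closed under arbitrary direct sums *)
  (forall (M : lmodType R^c) (I : Type) (P : I -> M -> Prop),
      (forall i, submod (P i)) -> indep P -> (forall i, inS S (P i)) ->
      inS S (sumfam P (@whole I))) ->
  (* R_R belongs to S *)
  S (R^c)^o ->
  (* finitely many indecomposables of finite length up to isomorphism *)
  (exists L : seq (lmodType R^c),
      forall X : lmodType R^c, S X -> indec (@whole X) -> finlen (@whole X) ->
        exists2 Y, List.In Y L & mod_iso X Y) ->
  (forall M : lmodType R^c, S M ->
     exists (I : Type) (P : I -> M -> Prop),
       (forall i, fingen (P i) /\ indec (P i)) /\ indep P /\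
       (forall m, sumfam P (@whole I) m))
  /\ (forall X : lmodType R^c, S X -> indec (@whole X) -> finlen (@whole X)).
Proof.
move=> [dccR _] S_sub _ _ [L LP].
(* Left ideals of the converse ring are, by conversion, the right ideals of [R]. *)
have dccT : dcc (@left_ideal R^c) := dccR.
pose d : lmodType R^c := (R^c)^o.
pose Z i : lmodType R^c := nth d L i.
have [b hb] := uniform_length d L.
(* [L] may list other modules too, so only suitable positions are kept. Isomorphic repetitions are
   harmless, as [rad_indep] and [in_rad] treat isomorphisms between different indices like
   automorphisms. *)
pose I := {i | [/\ (i < size L)%N, indec (@whole (Z i)) & finlen (@whole (Z i))]}.
pose Y (i : I) := Z (sval i).
have indecY i : indec (@whole (Y i)) by case: (svalP i).
have lenY i : lenle b (@zerom _ (Y i)) (@whole (Y i)).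
  by case: (svalP i) => iL _; exact: hb.
have Y_repr W : S W -> indec (@whole W) -> finlen (@whole W) ->
    exists i, mod_iso W (Y i).
  move=> SW indW finW; have [V /(In_nth d)[i iL <-] iso] := LP W SW indW finW.
  have [indV finV] := mod_iso_indec_finlen iso indW finW.
  by exists (exist _ i (And3 iL indV finV)).
have decomposition X : S X -> exists (K : Type) (P : K -> X -> Prop),
    [/\ forall i, finlen (P i), forall i, fingen (P i) /\ indec (P i), indep P &
        forall m, sumfam P (@whole K) m].
  move=> SX; have [A [Aind Amax]] := ex_maximal_rad_indep Y X.
  have pathN0 := harada_sai indecY lenY.
  have Aspan := in_span_all Aind Amax pathN0.
  exact: (direct_sum_decomposition dccT S_sub indecY lenY Y_repr SX Aind Aspan pathN0).
split=> [M|X] /decomposition[K [P [Pfin Pfg Pindep Psum]]].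
  by exists K, P.
move=> indX; apply: (finlen_of_decomposition indX Pfin _ Pindep Psum) => i.
by case: (Pfg i).
Qed.
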